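(* The topological conjugacy relation of minimal rotations on the $2$-torus is not amenable. That is, letting $X=\{(\alpha,\beta)\in(\mathbb{R}/\mathbb{Z})^2 : \alpha,\beta,1 \text{ are rationally independent}\}$ and $E$ the equivalence relation on $X$ given by $(\alpha,\beta)\,E\,(\alpha',\beta')$ iff the rotations $T_{\alpha,\beta}$ and $T_{\alpha',\beta'}$ are topologically conjugate, the countable Borel equivalence relation $E$ is not amenable.
   Context: For $(\alpha,\beta)\in(\mathbb{R}/\mathbb{Z})^2$, the rotation $T_{\alpha,\beta}$ of the torus $(\mathbb{R}/\mathbb{Z})^2$ is $T_{\alpha,\beta}(x,y)=(x+\alpha,y+\beta)$; it is minimal exactly when $\alpha,\beta,1$ are rationally independent. Two homeomorphisms $f,g$ of the torus are topologically conjugate if $h\circ f=g\circ h$ for some homeomorphism $h$ of the torus. A countable Borel equivalence relation $E$ on a standard Borel space $X$ is $\mu$-amenable, for a Borel probability measure $\mu$ on $X$, if there are Borel functions $\phi_n:E\to\mathbb{R}_{\ge 0}$ such that (1) for every $x\in X$, $\sum_{y E x}\phi_n(x,y)=1$, and (2) there is a Borel $E$-invariant set $A\subseteq X$ with $\mu(A)=1$ such that for all $(x,x')\in E\cap(A\times A)$, $\sum_{yEx}|\phi_n(x,y)-\phi_n(x',y)|\to 0$ as $n\to\infty$. $E$ is amenable if it is $\mu$-amenable for every Borel probability measure $\mu$ on $X$. *)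

(* Defs.v *)
From HB Require Import structures.
From mathcomp Require Import all_boot all_order all_algebra.
From mathcomp Require Import all_classical all_reals all_analysis.
From mathcomp Require Import Rstruct Rstruct_topology.

Set Implicit Arguments.
Unset Strict Implicit.
Unset Printing Implicit Defensive.
Import Order.TTheory GRing.Theory Num.Theory.
Local Open Scope classical_set_scope.
Local Open Scope ring_scope.

Definition RR : realType := Rdefinitions.R.

(** Points of the torus (R/Z)^2 are represented by their lifts in R^2.
    [tequiv p q] : p and q define the same point of the torus. *)
Definition tequiv (p q : RR * RR) : Prop :=
  exists m n : int, p.1 - q.1 = m%:~R /\ p.2 - q.2 = n%:~R.

(** [tnear e p q] : the (max-type) quotient distance on the torus between
    the classes of p and q is < e. *)
Definition tnear (e : RR) (p q : RR * RR) : Prop :=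
  exists m n : int, `|p.1 - q.1 - m%:~R| < e /\ `|p.2 - q.2 - n%:~R| < e.

Definition torus_map (h : RR * RR -> RR * RR) : Prop :=
  forall p q, tequiv p q -> tequiv (h p) (h q).

Definition torus_cont (h : RR * RR -> RR * RR) : Prop :=
  forall p (e : RR), 0 < e -> exists d : RR, 0 < d /\
    forall q, tnear d p q -> tnear e (h p) (h q).

Definition torus_homeo (h : RR * RR -> RR * RR) : Prop :=
  torus_map h /\ torus_cont h /\
  exists g : RR * RR -> RR * RR, torus_map g /\ torus_cont g /\
    (forall p, tequiv (g (h p)) p) /\ (forall p, tequiv (h (g p)) p).

Definition rot (a : RR * RR) (p : RR * RR) : RR * RR := (p.1 + a.1, p.2 + a.2).

Definition top_conj (f g : RR * RR -> RR * RR) : Prop :=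
  exists h, torus_homeo h /\ forall p, tequiv (h (f p)) (g (h p)).

Definition rat_indep (a : RR * RR) : Prop :=
  forall p q r : int, p%:~R * a.1 + q%:~R * a.2 + r%:~R = 0 :> RR ->
    p = 0 /\ q = 0 /\ r = 0.

(** X, with (R/Z)^2 represented by the fundamental domain [0,1)^2 *)
Definition Xmin : set (RR * RR) :=
  [set a | 0 <= a.1 < 1 /\ 0 <= a.2 < 1 /\ rat_indep a].

Definition Erel (a b : RR * RR) : Prop :=
  Xmin a /\ Xmin b /\ top_conj (rot a) (rot b).

Definition Eset : set ((RR * RR) * (RR * RR)) := [set z | Erel z.1 z.2].

Definition mu_amenable (mu : probability (RR * RR)%type RR) : Prop :=
  exists phi : nat -> (RR * RR) * (RR * RR) -> RR,
    (forall n, measurable_fun Eset (phi n)) /\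
    (forall n z, Eset z -> 0 <= phi n z) /\
    (forall n x, Xmin x ->
       (\esum_(y in [set y | Erel x y]) ((phi n (x, y))%:E) = 1)%E) /\
    exists A : set (RR * RR),
      measurable A /\ A `<=` Xmin /\
      (forall x y, Erel x y -> (A x <-> A y)) /\
      mu A = 1%E /\
      forall x x', A x -> A x' -> Erel x x' ->
        (fun n => \esum_(y in [set y | Erel x y])
                    ((`|phi n (x, y) - phi n (x', y)|)%:E)) @ \oo --> 0%E.

Definition amenable_E : Prop :=
  forall mu : probability (RR * RR)%type RR, mu Xmin = 1%E -> mu_amenable mu.

(* Main.v *)
Require Import Defs.
From HB Require Import structures.
From mathcomp Require Import all_boot all_order all_algebra.
From mathcomp Require Import all_classical all_reals all_analysis.
From mathcomp Require Import measurable_realfun.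
From mathcomp Require Import Rstruct Rstruct_topology.
From mathcomp Require Import ring lra zify.

(** Minimal rotations by x and y are conjugate iff y = Mx modulo Z^2 for some M
    in GL_2(Z): lifting a conjugacy h to the plane and subtracting its linear
    part gives a bounded function that a rotation increases by a constant, and
    this constant must vanish.  Such an M is unique, so the weights phi_n(x, .)
    on the class of x can be split according to the first row (a, b) of M, into
    the sectors |b| <= |a| and |a| <= |b|.  Replacing x by its images under the
    identity and the shears (x1 + 3 x2, x2), (x1 + 6 x2, x2) moves the first
    sector to three disjoint ones.  If phi_n(x, .) were asymptotically invariant,
    then, since shears preserve Lebesgue measure, the first sector would carry in
    the mean at most 1/3 of the mass in the limit.  By symmetry so would the
    second, but together they carry all of it. *)

Set Implicit Arguments.
Unset Strict Implicit.
Unset Printing Implicit Defensive.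
Import Order.TTheory GRing.Theory Num.Theory.
Import numFieldNormedType.Exports.
(* [Defs.rot] is shadowed by [seq.rot]. *)
Import Defs.
Local Open Scope classical_set_scope.
Local Open Scope ring_scope.

(** * Lebesgue measure on the torus *)

Section fractional_part.
Variable R : realType.
Implicit Types x y : R.

Definition frac x : R := x - (Num.floor x)%:~R.

Lemma frac_itv x : 0 <= frac x < 1.
Proof.
have := floor_itv x; rewrite /frac intrD => /andP[h1 h2].
by apply/andP; split; lra.
Qed.

Lemma frac_def x y (m : int) : 0 <= y < 1 -> x - y = m%:~R -> frac x = y.
Proof.
move=> hy e; rewrite /frac (@floor_def _ _ m) -?e; first by ring.
by rewrite intrD; move: hy => /andP[h1 h2]; apply/andP; split; lra.
Qed.

Lemma frac_id x : 0 <= x < 1 -> frac x = x.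
Proof. by move=> hx; apply: (@frac_def _ _ 0) => //; rewrite subrr. Qed.

Lemma fracDz x (m : int) : frac (x + m%:~R) = frac x.
Proof.
apply: (@frac_def _ _ (m + Num.floor x)) (frac_itv x) _.
by rewrite /frac intrD; ring.
Qed.

Lemma measurable_frac : measurable_fun setT frac.
Proof.
apply: measurable_funB => //.
apply: (@nondecreasing_measurable _ setT (fun x => (Num.floor x)%:~R)) => //.
by move=> x y xy; rewrite ler_int le_floor.
Qed.

End fractional_part.

(** Haar measure of the circle, carried by the fundamental domain but defined on subsets of the
    whole line, so that its square is a probability of the type over which [amenable_E]
    quantifies. *)
Definition circle_measure (R : realType) (A : set R) : \bar R :=
  lebesgue_measure (A `&` `[0 : R, 1 : R[).

Section circle_measure.
Variable R : realType.
Implicit Types A : set R.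
Local Notation nu := (@circle_measure R).

Let circle_measure0 : nu set0 = 0%E.
Proof. by rewrite /circle_measure set0I measure0. Qed.

Let circle_measure_ge0 A : (0 <= nu A)%E.
Proof. exact: measure_ge0. Qed.

Let circle_measure_sigma_additive : semi_sigma_additive nu.
Proof.
move=> F mF tF mU.
exact: (@measure_semi_sigma_additive _ _ _
  (mrestr (@lebesgue_measure R) (measurable_itv `[0 : R, 1[)) F mF tF mU).
Qed.

HB.instance Definition _ := isMeasure.Build default_measure_display R R nu
  circle_measure0 circle_measure_ge0 circle_measure_sigma_additive.

Let circle_measureT : nu setT = 1%:E.
Proof.
by rewrite /circle_measure setTI lebesgue_measure_itv /= lte_fin ltr01 sube0.
Qed.

HB.instance Definition _ := @Measure_isProbability.Build _ _ R nu circle_measureT.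

Lemma circle_measure1 (a : R) : nu [set a] = 0%E.
Proof.
apply/eqP; rewrite eq_le measure_ge0 andbT /circle_measure.
rewrite -(lebesgue_measure_set1 a); apply: le_measure; rewrite ?inE //.
exact: measurableI.
Qed.

(** Translations preserve the length of half-open intervals, and these lengths determine Lebesgue
    measure. *)
Lemma lebesgue_measureD (c : R) A : measurable A ->
  lebesgue_measure ((fun t => t + c) @^-1` A) = lebesgue_measure A.
Proof.
move=> mA; have mf : measurable_fun setT (fun t : R => t + c).
  exact: measurable_funD.
pose f : R -> measurableTypeR R := fun t => t + c.
have : pushforward lebesgue_measure f A = lebesgue_measure A.
  apply/esym/(@lebesgue_measure_unique _ (pushforward lebesgue_measure f)) => //=.
  move=> _ [[a b]] _ <-; rewrite /pushforward.
  have -> : f @^-1` `]a, b]%classic = `]a - c, b - c]%classic.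
    by apply/seteqP; split=> t /=; rewrite /f !in_itv /= ltrBlDr lerBrDr.
  rewrite !lebesgue_measure_itv /= !lte_fin ltrD2r -!EFinD.
  by case: ifP => // _; congr (_%:E); ring.
exact.
Qed.

(** A rotation by [e] in [0, 1) exchanges two intervals: it is the translation by [e] on [0, 1 - e)
    and by [e - 1] on [1 - e, 1). *)
Lemma circle_measure_rot (c : R) A : measurable A ->
  nu ((fun t => frac (t + c)) @^-1` A) = nu A.
Proof.
move=> mA; set D := _ @^-1` A.
have mD : measurable D.
  rewrite /D -[X in measurable X]setTI; apply: measurableT_comp => //.
  - exact: measurable_frac.
  - exact: measurable_funD.
have [e /andP[e0 e1] fE] : exists2 e : R, 0 <= e < 1 &
    forall t, frac (t + c) = frac (t + e).
  exists (frac c) => [|t]; first exact: frac_itv.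
  by rewrite -(fracDz (t + frac c) (Num.floor c)); congr frac; rewrite /frac; ring.
have spl (B : set R) (s : R) : measurable B -> 0 <= s <= 1 -> nu B =
    (lebesgue_measure (B `&` `[(0 : R)%R, s[) +
     lebesgue_measure (B `&` `[s, (1 : R)%R[))%E.
  move=> mB /andP[s0 s1].
  rewrite /circle_measure -measureU; last 3 first.
  - exact: measurableI.
  - exact: measurableI.
  - apply/seteqP; split=> // t [[_ h1] [_ h2]]; move: h1 h2 => /=.
    by rewrite !in_itv /=; lra.
  congr lebesgue_measure; rewrite -setIUr; congr (_ `&` _).
  apply/seteqP; split=> t /=; rewrite !in_itv /=; last first.
    case=> /andP[h1 h2]; first by rewrite h1 (lt_le_trans h2 s1).
    by rewrite (le_trans s0 h1) h2.
  by move/andP=> [h1 h2]; case: (ltP t s) => ts; [left; rewrite h1|right].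
rewrite (spl A e) ?(spl D (1 - e)) //; [|lra|lra].
rewrite addeC; congr (_ + _)%E.
- rewrite -[RHS](@lebesgue_measureD (e - 1)); last exact: measurableI.
  congr lebesgue_measure; apply/seteqP; split=> t; move: (t : R) => {}t /=;
    rewrite /D /= fE !in_itv /=.
  + move=> [At ht]; move: At; rewrite (@frac_def _ _ (t + (e - 1)) 1); [|lra|rewrite mulr1z; ring].
    by move=> At; split=> //; lra.
  + move=> [At ht]; rewrite (@frac_def _ _ (t + (e - 1)) 1); [|lra|rewrite mulr1z; ring].
    by split=> //; lra.
- rewrite -[RHS](@lebesgue_measureD e); last exact: measurableI.
  congr lebesgue_measure; apply/seteqP; split=> t; move: (t : R) => {}t /=;
    rewrite /D /= fE !in_itv /=.
  + move=> [At ht]; rewrite frac_id in At; [split=> //|]; lra.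
  + move=> [At ht]; rewrite frac_id; [split=> //|]; lra.
Qed.

End circle_measure.

Definition torus_measure (R : realType) := (@circle_measure R \x @circle_measure R)%E.

Section torus_measure.
Variable R : realType.
Local Notation nu := (@circle_measure R).
Local Notation mu := (@torus_measure R).
HB.instance Definition _ := Probability.copy mu (nu \x nu)%E.

(** The product measure is defined by integrating over vertical slices; by its uniqueness horizontal
    slices, which [shear1] rotates, give the same value. *)
Lemma torus_measureE2 (A : set (R * R)) : measurable A ->
  mu A = (\int[nu]_y nu (ysection A y))%E.
Proof.
move=> mA; rewrite /mu.
rewrite (@product_measure_unique _ _ _ _ R nu nu (nu \x^ nu)%E) // => B C mB mC.
exact: product_measure2E.
Qed.

(** The untouched coordinate is not reduced modulo 1, so this is the action of the matrix
    [((1, k), (0, 1))] only for points whose second coordinate lies in [0, 1). *)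
Definition shear1 (k : int) (z : R * R) : R * R := (frac (z.1 + k%:~R * z.2), z.2).
Definition shear2 (k : int) (z : R * R) : R * R := (z.1, frac (z.2 + k%:~R * z.1)).

Lemma measurable_shear1 k : measurable_fun setT (shear1 k).
Proof.
apply: measurable_fun_pair => //=.
apply: measurableT_comp; first exact: measurable_frac.
by apply: measurable_funD => //; exact: measurable_funM.
Qed.

Lemma measurable_shear2 k : measurable_fun setT (shear2 k).
Proof.
apply: measurable_fun_pair => //=.
apply: measurableT_comp; first exact: measurable_frac.
by apply: measurable_funD => //; exact: measurable_funM.
Qed.

(** On the slice at height [y] the shear is the rotation by [k * y]. *)
Lemma shear1_preserving k (A : set (R * R)) : measurable A ->
  mu (shear1 k @^-1` A) = mu A.
Proof.
move=> mA; have mB : measurable (shear1 k @^-1` A).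
  by rewrite -[X in measurable X]setTI; exact: measurable_shear1.
rewrite !torus_measureE2 //; apply: eq_integral => y _.
rewrite -[RHS](@circle_measure_rot _ (k%:~R * y)); last exact: measurable_ysection.
by rewrite !ysectionE.
Qed.

Lemma shear2_preserving k (A : set (R * R)) : measurable A ->
  mu (shear2 k @^-1` A) = mu A.
Proof.
move=> mA; rewrite /mu /product_measure1; apply: eq_integral => x _ /=.
rewrite -[RHS](@circle_measure_rot _ (k%:~R * x)); last exact: measurable_xsection.
by rewrite !xsectionE.
Qed.

(** For [b = 0] the line is a point times the whole axis; otherwise each vertical slice is a single
    point. *)
Lemma line_negligible (a b c : R) : (a, b) != (0, 0) ->
  mu [set z | a * z.1 + b * z.2 + c = 0] = 0%E.
Proof.
move=> ab; have [b0|b0] := eqVneq b 0.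
- have a0 : a != 0 by apply: contra ab => /eqP ->; rewrite b0.
  rewrite (_ : [set _ | _] = [set - c / a] `*` setT); last first.
    apply/seteqP; split=> -[x y] /=; rewrite b0.
    + by move=> h; split=> //; apply: (mulfI a0); rewrite mulrCA divff // mulr1; lra.
    + by move=> [-> _]; field.
  transitivity (nu [set (- c / a)%R] * nu setT)%E.
    by rewrite -product_measure1E.
  by rewrite circle_measure1 mul0e.
- rewrite /mu /product_measure1 integral0_eq //= => x _.
  rewrite (_ : xsection _ _ = [set - (c + a * x) / b]) ?circle_measure1 //.
  rewrite xsectionE; apply/seteqP; split=> y /=.
  + by move=> h; apply: (mulfI b0); rewrite mulrCA divff // mulr1; lra.
  + by move=> ->; field.
Qed.

End torus_measure.

(** * Semiconjugacies of torus rotations *)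

Section lifting.
Local Notation R := RR.

Definition int_diff (x y : R) : Prop := exists m : int, x - y = m%:~R.

Lemma int_diff_refl x : int_diff x x.
Proof. by exists 0; rewrite subrr. Qed.

Lemma int_diffD x y x' y' : int_diff x y -> int_diff x' y' ->
  int_diff (x + x') (y + y').
Proof. by move=> [m e] [m' e']; exists (m + m'); rewrite intrD -e -e'; ring. Qed.

Lemma int_diffB x y x' y' : int_diff x y -> int_diff x' y' ->
  int_diff (x - x') (y - y').
Proof. by move=> [m e] [m' e']; exists (m - m'); rewrite intrB -e -e'; ring. Qed.

Lemma int_diff_sym x y : int_diff x y -> int_diff y x.
Proof. by move=> [m e]; exists (- m); rewrite intrN -e; ring. Qed.

Lemma int_diff_trans x y z : int_diff x y -> int_diff y z -> int_diff x z.
Proof. by move=> [m e] [m' e']; exists (m + m'); rewrite intrD -e -e'; ring. Qed.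

Lemma int_diff_eq x y : int_diff x y -> `|x - y| < 1 -> x = y.
Proof.
move=> [m e]; rewrite e -intr_norm -[1]/(1%:~R) ltr_int => m1.
have m0 : m = 0 by lia.
by apply/eqP; rewrite -subr_eq0 e m0.
Qed.

(** The representative of [x] modulo 1 in [-1/2, 1/2). *)
Definition centered (x : R) : R := x - (Num.floor (x + 1 / 2))%:~R.

Lemma centered_def x y : int_diff x y -> `|y| < 1 / 2 -> centered x = y.
Proof.
move=> [m e]; rewrite ltr_norml => /andP[y1 y2].
rewrite /centered (@floor_def _ _ m) -?e; first by ring.
by rewrite intrD -e; apply/andP; split; lra.
Qed.

Lemma centered_int_diff x : int_diff x (centered x).
Proof. by exists (Num.floor (x + 1 / 2)); rewrite /centered; ring. Qed.

Lemma centered_small x (m : int) : `|x - m%:~R| < 1 / 8 -> `|centered x| < 1 / 8.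
Proof.
move=> h; rewrite (@centered_def _ (x - m%:~R)) //; last lra.
by exists m; ring.
Qed.

(** Three terms below 1/8 add up to less than 1/2 in absolute value, so no integer is lost. *)
Lemma centered_alternating x y z : `|centered x| < 1 / 8 ->
  `|centered y| < 1 / 8 -> `|centered z| < 1 / 8 ->
  centered (x - y + z) = centered x - centered y + centered z.
Proof.
move=> hx hy hz; apply: centered_def.
  by apply: int_diffD; [apply: int_diffB|]; exact: centered_int_diff.
by move: hx hy hz; rewrite !ltr_norml; lra.
Qed.

(** * Chains of small steps along the rays of a square *)

Definition in_box (c : R) (p : R * R) : Prop := 0 <= p.1 <= c /\ 0 <= p.2 <= c.
Definition close (d : R) (p q : R * R) : Prop :=
  `|p.1 - q.1| < d /\ `|p.2 - q.2| < d.
Definition dilate (t : R) (p : R * R) : R * R := (t * p.1, t * p.2).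

Lemma dilate_box c t p : 0 <= t <= 1 -> in_box c p -> in_box c (dilate t p).
Proof.
move=> /andP[t0 t1] [/andP[h1 h2] /andP[h3 h4]]; split=> /=; apply/andP; split;
  by [nra|exact: mulr_ge0].
Qed.

Lemma dilate_close d t p q : 0 <= t <= 1 -> close d p q ->
  close d (dilate t p) (dilate t q).
Proof.
move=> /andP[t0 t1] [h1 h2]; split=> /=; rewrite -mulrBr normrM (ger0_norm t0);
  by [apply: le_lt_trans h1; rewrite ler_piMl | apply: le_lt_trans h2; rewrite ler_piMl].
Qed.

Lemma fine_subdivision (c d : R) : 0 < d -> exists N : nat, (0 < N)%N /\
  forall p, in_box c p -> forall i, 
   close d (dilate (i%:R / N%:R) p) (dilate (i.+1%:R / N%:R) p).
Proof.
move=> d0; have [c0|c0] := ltP c 0.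
  by exists 1%N; split=> // p [/andP[h1 h2] _]; lra.
pose N := (Num.trunc (c / d)).+1.
have hN : c / d < N%:R by exact: truncnS_gt.
have N0 : 0 < N%:R :> R by rewrite ltr0n.
have cN : c / N%:R < d.
  by rewrite ltr_pdivrMr // mulrC -ltr_pdivrMr.
exists N; split=> // p [/andP[h1 h2] /andP[h3 h4]] i.
have e (x : R) : i%:R / N%:R * x - i.+1%:R / N%:R * x = - (x / N%:R).
  by rewrite -natr1; field; rewrite gt_eqF.
split=> /=; rewrite e normrN ger0_norm ?divr_ge0 ?(ltW N0) //;
  by apply: le_lt_trans cN; rewrite ler_pM2r // invr_gt0.
Qed.

Lemma subdivision_itv (N i : nat) : (0 < N)%N -> (i <= N)%N ->
  0 <= (i%:R / N%:R : R) <= 1.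
Proof.
move=> N0 iN; apply/andP; split; first by rewrite divr_ge0.
by rewrite ler_pdivrMr ?ltr0n // mul1r ler_nat.
Qed.

Lemma dilate1 (N : nat) p : (0 < N)%N -> dilate (N%:R / N%:R) p = p.
Proof.
by move=> N0; case: p => x y; rewrite /dilate /= divff ?mul1r // pnatr_eq0 -lt0n.
Qed.

Lemma dilate0 (N : nat) p : dilate (0%N%:R / N%:R) p = (0, 0).
Proof. by rewrite /dilate !mul0r. Qed.

(** Every point of the box is reached from the origin in [N] steps, each changing [F] by less than
    1. *)
Lemma chain_bounded (F : R * R -> R) (c d : R) : 0 < d ->
  (forall p q, in_box c p -> in_box c q -> close d p q -> `|F p - F q| < 1) ->
  exists N : nat, forall p, in_box c p -> `|F p - F (0, 0)| <= N%:R.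
Proof.
move=> d0 hF; have [N [N0 hN]] := fine_subdivision c d0.
exists N => p hp; rewrite -{1}(dilate1 p N0).
suff H i : (i <= N)%N ->
    `|F (dilate (i%:R / N%:R) p) - F (0, 0)| <= i%:R by exact: H.
elim: i => [|i IH] iN; first by rewrite dilate0 subrr normr0.
have i1 := subdivision_itv N0 iN; have i0 := subdivision_itv N0 (ltnW iN).
have := hF _ _ (dilate_box i0 hp) (dilate_box i1 hp) (hN p hp i).
move: (IH (ltnW iN)) => h1 h2.
rewrite -(subrKA (F (dilate (i%:R / N%:R) p))).
apply: le_trans (ler_normD _ _) _; rewrite addrC -[leRHS]natr1.
by apply: lerD => //; rewrite distrC ltW.
Qed.

(** A discrete form of connectedness: along the ray [F] changes by integers of absolute value less
    than 1. *)
Lemma chain_constant (F : R * R -> R) (c d : R) : 0 < d ->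
  (forall p, in_box c p -> int_diff (F p) (F (0, 0))) ->
  (forall p q, in_box c p -> in_box c q -> close d p q -> `|F p - F q| < 1) ->
  forall p, in_box c p -> F p = F (0, 0).
Proof.
move=> d0 Fint hF; have [N [N0 hN]] := fine_subdivision c d0.
move=> p hp; rewrite -{1}(dilate1 p N0).
suff H i : (i <= N)%N -> F (dilate (i%:R / N%:R) p) = F (0, 0) by exact: H.
elim: i => [|i IH] iN; first by rewrite dilate0.
have i1 := subdivision_itv N0 iN; have i0 := subdivision_itv N0 (ltnW iN).
have bi1 := dilate_box i1 hp; have bi0 := dilate_box i0 hp.
rewrite -(IH (ltnW iN)); apply/esym/int_diff_eq.
  exact: int_diff_trans (Fint _ bi0) (int_diff_sym (Fint _ bi1)).
by apply: hF => //; exact: hN.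
Qed.

Section lift.
Variables (g : R * R -> R) (d : R).
Hypothesis d_gt0 : 0 < d.
Hypothesis g_close : forall p q, close d p q ->
  exists m : int, `|g q - g p - m%:~R| < 1 / 8.

Let step p q := centered (g q - g p).

Let step_small p q : close d p q -> `|step p q| < 1 / 8.
Proof. by move=> /g_close[m]; exact: centered_small. Qed.

(** Path lifting along rays: [f] adds up the centered increments of [g] on the [N] steps from the
    origin. Rays to close points are compared step by step, which makes [f] nearly continuous across
    rays as well. *)
Lemma exists_lift c : exists f : R * R -> R,
  (forall p, int_diff (f p) (g p)) /\
  (forall p q, in_box c p -> in_box c q -> close d p q -> `|f p - f q| < 1 / 8).
Proof.
have [N [N0 hN]] := fine_subdivision c d_gt0.
pose z i p := dilate (i%:R / N%:R) p.
pose f n p := g (0, 0) + \sum_(i < n) step (z i p) (z i.+1 p).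
have fS n p : f n.+1 p = f n p + step (z n p) (z n.+1 p).
  by rewrite /f big_ord_recr /= addrA.
have f_lift n p : int_diff (f n p) (g (z n p)).
  elim: n => [|n IH]; first by rewrite /f big_ord0 addr0 /z dilate0; exact: int_diff_refl.
  rewrite fS -[g (z n.+1 p)](subrKC (g (z n p))).
  exact: int_diffD IH (int_diff_sym (centered_int_diff _)).
have f_close p q : in_box c p -> in_box c q -> close d p q -> forall n, (n <= N)%N ->
    f n q - f n p = step (z n p) (z n q).
  move=> hp hq pq; elim=> [|n IH] nN.
    rewrite /f !big_ord0 !addr0 /z !dilate0 /step !subrr.
    by apply/esym/centered_def; rewrite ?normr0; [exact: int_diff_refl|lra].
  have n0 := subdivision_itv N0 (ltnW nN).
  rewrite !fS.
  (* Three sides of the small quadrilateral between the two rays; their alternating sum is the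
     fourth side. *)
  transitivity (step (z n q) (z n.+1 q) - step (z n p) (z n.+1 p) + (f n q - f n p)).
    by ring.
  rewrite (IH (ltnW nN)) /step -centered_alternating.
  - by congr centered; ring.
  - by apply: step_small; exact: hN.
  - by apply: step_small; exact: hN.
  - by apply: step_small; exact: dilate_close.
exists (f N); split=> [p|p q hp hq pq].
  by have := f_lift N p; rewrite /z dilate1.
rewrite distrC f_close // step_small // /z !dilate1 //.
Qed.

End lift.

Lemma bounded_multiples_eq0 (x C : R) : (forall n : nat, `|n%:R * x| <= C) -> x = 0.
Proof.
move=> h; apply/eqP/contraT => x0; have nx : 0 < `|x| by rewrite normr_gt0.
have := h (Num.trunc (C / `|x|)).+1; rewrite normrM ger0_norm ?ler0n //.
by rewrite -ler_pdivlMr // leNgt truncnS_gt.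
Qed.

(* The lift [f] of [g] satisfies [f (p + e_i) = f p + m_i], so that
   [f p - m_1 p_1 - m_2 p_2] descends to the torus and is bounded; it increases
   by a constant under the rotation, and this constant must therefore vanish. *)
Lemma semiconjugate_rotation (g : R * R -> R) (a : R * R) (b d : R) :
  0 <= a.1 < 1 -> 0 <= a.2 < 1 -> 0 < d ->
  (forall p q, close d p q -> exists m : int, `|g q - g p - m%:~R| < 1 / 8) ->
  (forall p q, tequiv p q -> int_diff (g p) (g q)) ->
  (forall p, int_diff (g (p.1 + a.1, p.2 + a.2)) (g p + b)) ->
  exists m n k : int, b = m%:~R * a.1 + n%:~R * a.2 + k%:~R.
Proof.
move=> a1 a2 d0 g_close g_per g_rot.
(* Side 3 leaves room to move points of the box of side 2 by vectors of the unit square. *)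
have [f [f_lift f_close]] := exists_lift d0 g_close 3.
(* The difference [F] is congruent to [c] modulo 1 everywhere and changes by less than 1/4 in a
   small step, hence it is constant. *)
have shift v : 0 <= v.1 <= 1 -> 0 <= v.2 <= 1 -> forall c,
    (forall p, int_diff (g (p.1 + v.1, p.2 + v.2)) (g p + c)) ->
    forall p, in_box 2 p ->
    f (p.1 + v.1, p.2 + v.2) - f p = f (v.1, v.2) - f (0, 0).
  move=> v1 v2 c gv p hp.
  pose F p := f (p.1 + v.1, p.2 + v.2) - f p.
  have Fc q : int_diff (F q) c.
    have := int_diffB (int_diff_trans (f_lift (q.1 + v.1, q.2 + v.2)) (gv q)) (f_lift q).
    by rewrite addrAC subrr add0r.
  have -> : f (v.1, v.2) - f (0, 0) = F (0, 0) by rewrite /F /= !add0r.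
  apply: (@chain_constant F 2 d d0) => //.
    by move=> q _; exact: int_diff_trans (Fc _) (int_diff_sym (Fc _)).
  move=> q r [q1 q2] [r1 r2] [h1 h2].
  have hq : `|f (q.1 + v.1, q.2 + v.2) - f (r.1 + v.1, r.2 + v.2)| < 1 / 8.
    apply: f_close; [by split=> /=; lra|by split=> /=; lra|].
    by split; rewrite /= opprD addrACA subrr addr0.
  have hr : `|f q - f r| < 1 / 8 by apply: f_close => //; split; lra.
  by rewrite /F; move: hq hr; rewrite !ltr_norml; lra.
have int1 : int_diff (f (1, 0) - f (0, 0)) 0.
  have /g_per h : tequiv (1, 0) (0, 0) by exists 1, 0 => /=; split; rewrite subr0.
  have := int_diffB (int_diff_trans (f_lift (1, 0)) h) (f_lift (0, 0)).
  by rewrite subrr.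
have int2 : int_diff (f (0, 1) - f (0, 0)) 0.
  have /g_per h : tequiv (0, 1) (0, 0) by exists 0, 1 => /=; split; rewrite subr0.
  have := int_diffB (int_diff_trans (f_lift (0, 1)) h) (f_lift (0, 0)).
  by rewrite subrr.
case: int1 => m; rewrite subr0 => em; case: int2 => n; rewrite subr0 => en.
have z01 : 0 <= (0 : R) <= 1 by rewrite lexx ler01.
have o01 : 0 <= (1 : R) <= 1 by rewrite lexx ler01.
have f1 p : in_box 2 p -> f (p.1 + 1, p.2) = f p + m%:~R.
  move=> hp; have h q : int_diff (g (q.1 + (1 : R, 0 : R).1, q.2 + (1 : R, 0 : R).2)) (g q + 0).
    by rewrite /= !addr0; apply: g_per; exists 1, 0; split=> /=; ring.
  have := shift (1, 0) o01 z01 0 h p hp; rewrite /= addr0 em => <-.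
  by ring.
have f2 p : in_box 2 p -> f (p.1, p.2 + 1) = f p + n%:~R.
  move=> hp; have h q : int_diff (g (q.1 + (0 : R, 1 : R).1, q.2 + (0 : R, 1 : R).2)) (g q + 0).
    by rewrite /= !addr0; apply: g_per; exists 0, 1; split=> /=; ring.
  have := shift (0, 1) z01 o01 0 h p hp; rewrite /= addr0 en => <-.
  by ring.
have f1' x y (h : in_box 2 (x, y)) : f (x + 1, y) = f (x, y) + m%:~R := f1 (x, y) h.
have f2' x y (h : in_box 2 (x, y)) : f (x, y + 1) = f (x, y) + n%:~R := f2 (x, y) h.
have [k ek] : int_diff b (f (a.1, a.2) - f (0, 0)).
  apply: int_diff_sym; have := int_diffB (f_lift (0 + a.1, 0 + a.2)) (f_lift (0, 0)).
  move/int_diff_trans; rewrite !add0r; apply.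
  have := int_diffB (g_rot (0, 0)) (int_diff_refl (g (0, 0))); rewrite /= !add0r.
  by rewrite addrAC subrr add0r.
pose c := f (a.1, a.2) - f (0, 0).
have fa p : in_box 2 p -> f (p.1 + a.1, p.2 + a.2) = f p + c.
  move=> hp; rewrite /c -(shift a _ _ b g_rot p hp); [by ring|by lra|by lra].
pose psi p := f p - m%:~R * p.1 - n%:~R * p.2.
pose w := c - m%:~R * a.1 - n%:~R * a.2.
pose next (p : R * R) := (frac (p.1 + a.1), frac (p.2 + a.2)).
have [N hN] : exists N : nat, forall p, in_box 2 p -> `|f p - f (0, 0)| <= N%:R.
  apply: (@chain_bounded f 2 d d0) => p q [p1 p2] [q1 q2] pq.
  apply: lt_trans (_ : 1 / 8 < 1); last lra.
  by apply: f_close => //; split; lra.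
have frac01 (x y : R) : 0 <= x < 1 -> 0 <= y < 1 ->
    frac (x + y) = x + y \/ frac (x + y) + 1 = x + y.
  move=> hx hy; have [h|h] := ltP (x + y) 1; [left|right].
    by rewrite frac_id //; lra.
  by rewrite (@frac_def _ _ (x + y - 1) 1); [ring|lra|rewrite mulr1z; ring].
pose ok (p : R * R) := 0 <= p.1 < 1 /\ 0 <= p.2 < 1.
(* Reducing [p + a] subtracts 0 or 1 from each coordinate; [f] then changes by [m] or [n], which the
   linear part of [psi] cancels. *)
have psi_next p : ok p -> psi (next p) = psi p + w.
  move=> [p1 p2].
  have np1 := frac_itv (p.1 + a.1); have np2 := frac_itv (p.2 + a.2).
  transitivity (psi (p.1 + a.1, p.2 + a.2)); last first.
    rewrite /psi fa /=; last by split; lra.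
    by rewrite /w; ring.
  rewrite /psi /next /=.
  move: np1 np2 (frac01 _ _ p1 a1) (frac01 _ _ p2 a2).
  move: (frac (p.1 + a.1)) (frac (p.2 + a.2)) => x y hx hy [<-|<-] [<-|<-] //.
  - rewrite f2'; last by split=> /=; lra.
    by ring.
  - rewrite f1'; last by split=> /=; lra.
    by ring.
  - rewrite f2'; last by split=> /=; lra.
    rewrite f1'; last by split=> /=; lra.
    by ring.
pose orb i := iter i next (0, 0).
have orb_ok i : ok (orb i).
  case: i => [|i]; first by split=> /=; lra.
  by split=> /=; exact: frac_itv.
have psi_orb i : psi (orb i) = psi (0, 0) + i%:R * w.
  elim: i => [|i IH]; first by rewrite mul0r addr0.
  by rewrite /orb iterS psi_next ?IH; [rewrite -natr1; ring|exact: orb_ok].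
(* The orbit stays in the unit square, where [f] and the linear part are bounded, so all multiples
   of [w] are bounded. *)
have w0 : w = 0.
  apply: (@bounded_multiples_eq0 _ (N%:R + `|m%:~R| + `|n%:~R|)) => i.
  have [r1 r2] := orb_ok i; have hb : in_box 2 (orb i) by split; lra.
  have -> : (i%:R * w : R) = f (orb i) - f (0, 0) - m%:~R * (orb i).1 - n%:~R * (orb i).2.
    by have := psi_orb i; rewrite /psi /=; lra.
  have bd (x y : R) : 0 <= y < 1 -> `|x * y| <= `|x|.
    move=> /andP[y0 y1]; rewrite normrM (ger0_norm y0).
    by rewrite -[leRHS]mulr1; apply: ler_wpM2l => //; exact: ltW.
  apply: le_trans (ler_normB _ _) _; apply: lerD; last exact: bd.
  apply: le_trans (ler_normB _ _) _; apply: lerD; last exact: bd.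
  exact: hN.
exists m, n, k; move: w0 ek; rewrite /w /c; lra.
Qed.

(** Compactness of the unit square gives a common [d] for base points in it; periodicity carries
    this to all base points. *)
Lemma torus_cont_uniform (g : R * R -> R) :
  (forall p q, tequiv p q -> int_diff (g p) (g q)) ->
  (forall p (e : R), 0 < e -> exists d : R, 0 < d /\
    forall q, tnear d p q -> exists m : int, `|g p - g q - m%:~R| < e) ->
  exists d : R, 0 < d /\ forall p q, close d p q ->
    exists m : int, `|g q - g p - m%:~R| < 1 / 8.
Proof.
move=> g_per g_cont.
pose K : set (R * R) := `[0, 1]%classic `*` `[0, 1]%classic.
have /compact_near_coveringP cK : compact K.
  by apply: compact_setX; exact: segment_compact.
pose P (n : nat) (p : R * R) := forall q, close n.+1%:R^-1 p q ->
  exists m : int, `|g q - g p - m%:~R| < 1 / 8.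
have [N _ hN] : \forall n \near \oo, K `<=` P n.
  apply: cK => x Kx.
  (* Both [p] and [q] are compared with the center [x], so the error doubles and each of the two
     distances gets half of [d]. *)
  have [d [d0 hd]] := g_cont x (1 / 16) ltac:(lra).
  have d2 : 0 < d / 2 by lra.
  exists (ball x (d / 2), [set n : nat | n.+1%:R^-1 < d / 2 :> R]) => /=.
    split; first exact: nbhsx_ballx.
    exists (Num.trunc (d / 2)^-1) => // n /= hn.
    rewrite -[ltRHS]invrK ltf_pV2 ?posrE ?ltr0n ?invr_gt0 //.
    apply: lt_le_trans (truncnS_gt _) _; rewrite ler_nat ltnS; exact: hn.
  move=> [p n] /= [[xp1 xp2] nd] q [pq1 pq2].
  have [|mp hp] := hd p.
    by exists 0, 0; rewrite !subr0; split; apply: lt_le_trans (_ : _ < d / 2) _ => //; lra.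
  have [|mq hq] := hd q.
    exists 0, 0; rewrite !subr0; split.
      rewrite -(subrKA p.1); apply: le_lt_trans (ler_normD _ _) _.
      by rewrite (splitr d); apply: ltrD => //; exact: lt_trans nd.
    rewrite -(subrKA p.2); apply: le_lt_trans (ler_normD _ _) _.
    by rewrite (splitr d); apply: ltrD => //; exact: lt_trans nd.
  exists (mp - mq); rewrite intrB; move: hp hq; rewrite !ltr_norml; lra.
exists N.+1%:R^-1; split; first by rewrite invr_gt0 ltr0n.
move=> p q [pq1 pq2].
(* Both points move by the same integral vector, which keeps their difference; [q'] may leave the
   square. *)
pose p' := (frac p.1, frac p.2); pose q' := (q.1 - (Num.floor p.1)%:~R, q.2 - (Num.floor p.2)%:~R).
have Kp' : K p' by split; rewrite /= in_itv /=; [have := frac_itv p.1|have := frac_itv p.2]; lra.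
have [||m hm] := hN N _ p' Kp' q' _.
- by rewrite /=.
- have e (x y c : R) : x - c - (y - c) = x - y by ring.
  by split; rewrite /= /frac e.
have [kp ep] : int_diff (g p) (g p').
  by apply: g_per; exists (Num.floor p.1), (Num.floor p.2); rewrite /p' /frac /=; split; ring.
have [kq eq] : int_diff (g q) (g q').
  by apply: g_per; exists (Num.floor p.1), (Num.floor p.2); rewrite /q' /=; split; ring.
exists (m + kq - kp); rewrite intrB intrD -ep -eq.
by move: hm; congr (`|_| < _); ring.
Qed.

End lifting.

(** * Conjugate rotations differ by an integral matrix *)

Section conjugacy.
Local Notation R := RR.

Lemma tequivP (p q : R * R) :
  tequiv p q <-> int_diff p.1 q.1 /\ int_diff p.2 q.2.
Proof.
split=> [[m [n [hm hn]]]|[[m hm] [n hn]]]; last by exists m, n.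
by split; [exists m|exists n].
Qed.

Lemma tequiv_refl p : tequiv p p.
Proof. by apply/tequivP; split; exact: int_diff_refl. Qed.

Lemma tequiv_sym p q : tequiv p q -> tequiv q p.
Proof.
by move=> /tequivP[h1 h2]; apply/tequivP; split; exact: int_diff_sym.
Qed.

Lemma tequiv_trans p q r : tequiv p q -> tequiv q r -> tequiv p r.
Proof.
move=> /tequivP[h1 h2] /tequivP[h3 h4]; apply/tequivP.
by split; [exact: int_diff_trans h3|exact: int_diff_trans h4].
Qed.

Lemma tequiv_rot a p q : tequiv p q -> tequiv (rot a p) (rot a q).
Proof.
move=> /tequivP[h1 h2]; apply/tequivP.
by split; apply: int_diffD => //; exact: int_diff_refl.
Qed.

Lemma top_conj_rot_sym x y : top_conj (rot x) (rot y) -> top_conj (rot y) (rot x).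
Proof.
move=> [h [[hm [hc [g [gm [gc [gh hg]]]]]] hconj]].
exists g; split; first by split=> //; split=> //; exists h.
move=> p; apply: tequiv_trans (gh _); apply: gm.
apply: tequiv_sym; apply: tequiv_trans (hconj _) _.
exact/tequiv_rot/hg.
Qed.

(* [((a, b), (c, d))] is the matrix with rows [(a, b)] and [(c, d)]. *)
Definition mat := (int * int * (int * int))%type.
Definition mat_det (M : mat) : int := M.1.1 * M.2.2 - M.1.2 * M.2.1.
(** An integer is invertible exactly when its square is 1. *)
Definition GL2Z : set mat := [set M | mat_det M * mat_det M = 1].
Definition lin (M : mat) (p : R * R) : R * R :=
  (M.1.1%:~R * p.1 + M.1.2%:~R * p.2, M.2.1%:~R * p.1 + M.2.2%:~R * p.2).
Definition act (M : mat) (p : R * R) : R * R :=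
  (frac (lin M p).1, frac (lin M p).2).

Lemma act_tequiv M p : tequiv (act M p) (lin M p).
Proof.
apply/tequivP; split; apply: int_diff_sym;
  by [exists (Num.floor (lin M p).1); rewrite /act /frac /=; ring
     |exists (Num.floor (lin M p).2); rewrite /act /frac /=; ring].
Qed.

Lemma act_unique M p q : 0 <= q.1 < 1 -> 0 <= q.2 < 1 -> tequiv q (lin M p) ->
  q = act M p.
Proof.
move=> q1 q2 /tequivP[/int_diff_sym [m hm] /int_diff_sym [n hn]].
by rewrite /act (frac_def q1 hm) (frac_def q2 hn); case: q {q1 q2 hm hn}.
Qed.

(** Each coordinate of the conjugacy is a semiconjugacy to a circle rotation and yields one row of
    [M]. *)
Lemma top_conj_lin x y : 0 <= x.1 < 1 -> 0 <= x.2 < 1 ->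
  top_conj (rot x) (rot y) -> exists M, tequiv y (lin M x).
Proof.
move=> x1 x2 [h [[hm [hc _]] hconj]].
have [||d1 [d10 hd1]] := @torus_cont_uniform (fst \o h).
- by move=> p q /hm /tequivP[].
- move=> p e e0; have [d [d0 hd]] := hc p e e0.
  by exists d; split=> // q /hd[m [n [? _]]]; exists m.
have [||d2 [d20 hd2]] := @torus_cont_uniform (snd \o h).
- by move=> p q /hm /tequivP[].
- move=> p e e0; have [d [d0 hd]] := hc p e e0.
  by exists d; split=> // q /hd[m [n [_ ?]]]; exists n.
have [||m [n [k e1]]] := @semiconjugate_rotation _ x y.1 _ x1 x2 d10 hd1.
- by move=> p q /hm /tequivP[].
- by move=> p; have /tequivP[] := hconj p.
have [||m' [n' [k' e2]]] := @semiconjugate_rotation _ x y.2 _ x1 x2 d20 hd2.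
- by move=> p q /hm /tequivP[].
- by move=> p; have /tequivP[] := hconj p.
exists ((m, n), (m', n')); apply/tequivP; rewrite /lin /=.
by split; [exists k; rewrite e1|exists k'; rewrite e2]; ring.
Qed.

(** * Integral matrices acting on the torus *)

Definition mat_mul (M N : mat) : mat :=
  ((M.1.1 * N.1.1 + M.1.2 * N.2.1, M.1.1 * N.1.2 + M.1.2 * N.2.2),
   (M.2.1 * N.1.1 + M.2.2 * N.2.1, M.2.1 * N.1.2 + M.2.2 * N.2.2)).
Definition mat1 : mat := ((1, 0), (0, 1)).
(** The adjugate times the determinant, which is its own inverse on [GL2Z]. *)
Definition mat_inv (M : mat) : mat :=
  let d := mat_det M in ((d * M.2.2, - (d * M.1.2)), (- (d * M.2.1), d * M.1.1)).

Lemma mat_detM M N : mat_det (mat_mul M N) = mat_det M * mat_det N.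
Proof. by rewrite /mat_det /mat_mul /=; ring. Qed.

Lemma lin_mul M N p : lin (mat_mul M N) p = lin M (lin N p).
Proof. by rewrite /lin /mat_mul /= !intrD !intrM; congr (_, _); ring. Qed.

Lemma lin1 p : lin mat1 p = p.
Proof. by case: p => x y; rewrite /lin /=; congr (_, _); ring. Qed.

Lemma mat_mulV M : GL2Z M -> mat_mul M (mat_inv M) = mat1.
Proof.
case: M => -[a b] [c d]; rewrite /GL2Z /mat_mul /mat_inv /mat1 /mat_det /= => h.
by congr ((_, _), (_, _)); try ring; rewrite -h; ring.
Qed.

Lemma mat_mulVl M : GL2Z M -> mat_mul (mat_inv M) M = mat1.
Proof.
case: M => -[a b] [c d]; rewrite /GL2Z /mat_mul /mat_inv /mat1 /mat_det /= => h.
by congr ((_, _), (_, _)); try ring; rewrite -h; ring.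
Qed.

Lemma lin_tequiv M p q : tequiv p q -> tequiv (lin M p) (lin M q).
Proof.
move=> [m [n [hm hn]]].
exists (M.1.1 * m + M.1.2 * n), (M.2.1 * m + M.2.2 * n).
by rewrite !intrD !intrM -hm -hn /lin /=; split; ring.
Qed.

Lemma lin_cont M : torus_cont (lin M).
Proof.
move=> p e e0.
have lt_comb (u v x y d : R) : `|u| < d -> `|v| < d ->
    d * (1 + `|x| + `|y|) <= e -> `|x * u + y * v| < e.
  move=> hu hv de; apply: le_lt_trans (ler_normD _ _) _; rewrite !normrM.
  have h1 : `|x| * `|u| <= `|x| * d by rewrite ler_wpM2l // ltW.
  have h2 : `|y| * `|v| <= `|y| * d by rewrite ler_wpM2l // ltW.
  have d0 : 0 < d by exact: le_lt_trans (normr_ge0 u) hu.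
  by apply: lt_le_trans de; lra.
pose C1 := 1 + `|M.1.1%:~R : R| + `|M.1.2%:~R : R|.
pose C2 := 1 + `|M.2.1%:~R : R| + `|M.2.2%:~R : R|.
have C11 : 1 <= C1 by rewrite /C1 -addrA lerDl addr_ge0.
have C21 : 1 <= C2 by rewrite /C2 -addrA lerDl addr_ge0.
have C10 : 0 < C1 by exact: lt_le_trans ltr01 C11.
have C20 : 0 < C2 by exact: lt_le_trans ltr01 C21.
(* Multiplied by either row bound, this leaves [e] divided by the other bound, which is at least
   1. *)
exists (e / (C1 * C2)); split; first by rewrite divr_gt0 // mulr_gt0.
move=> q [m [n [hm hn]]].
exists (M.1.1 * m + M.1.2 * n), (M.2.1 * m + M.2.2 * n).
rewrite !intrD !intrM /lin /=.
have distr (x y x1 y1 x2 y2 u v : R) : x * x1 + y * y1 - (x * x2 + y * y2) - (x * u + y * v) =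
    x * (x1 - x2 - u) + y * (y1 - y2 - v) by ring.
split; rewrite distr; apply: (lt_comb _ _ _ _ _ hm hn).
- rewrite -/C1 invfM mulrA mulrAC divfK ?gt_eqF //.
  by rewrite ler_pdivrMr // ler_peMr // ltW.
- rewrite -/C2 invfM mulrA divfK ?gt_eqF //.
  by rewrite ler_pdivrMr // ler_peMr // ltW.
Qed.

Lemma lin_homeo M : GL2Z M -> torus_homeo (lin M).
Proof.
move=> hM; split; first exact: lin_tequiv.
split; first exact: lin_cont.
exists (lin (mat_inv M)); split; first exact: lin_tequiv.
split; first exact: lin_cont.
by split=> p; rewrite -lin_mul ?mat_mulV ?mat_mulVl // lin1; exact: tequiv_refl.
Qed.

(** Subtracting corresponding rows gives two integral relations between the coordinates of [x] and
    1. *)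
Lemma rat_indep_lin_inj x M N : rat_indep x -> tequiv (lin M x) (lin N x) -> M = N.
Proof.
move=> ix [m [n []]]; case: M => -[a b] [c d]; case: N => -[a' b'] [c' d'].
rewrite /lin /= => h1 h2.
have [/eqP e1 [/eqP e2 _]] : a - a' = 0 /\ b - b' = 0 /\ - m = 0.
  by apply: ix; rewrite !intrB intrN -h1; ring.
have [/eqP e3 [/eqP e4 _]] : c - c' = 0 /\ d - d' = 0 /\ - n = 0.
  by apply: ix; rewrite !intrB intrN -h2; ring.
by move: e1 e2 e3 e4; rewrite !subr_eq0 => /eqP-> /eqP-> /eqP-> /eqP->.
Qed.

Lemma act_inj x M N : Xmin x -> act M x = act N x -> M = N.
Proof.
move=> [_ [_ ix]] e; apply: (rat_indep_lin_inj ix).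
apply: tequiv_trans (tequiv_sym (act_tequiv _ _)) _.
by rewrite e; exact: act_tequiv.
Qed.

(** A relation for [act M x] with coefficients [(p, q)] is one for [x] with coefficients [(p, q) M],
    and [M] is invertible. *)
Lemma Xmin_act x M : Xmin x -> GL2Z M -> Xmin (act M x).
Proof.
move=> [_ [_ ix]] hM; split; first exact: frac_itv.
split; first exact: frac_itv.
have [m [n [hm hn]]] := act_tequiv M x.
move=> p q r.
have -> : (act M x).1 = (lin M x).1 + m%:~R by rewrite -hm; ring.
have -> : (act M x).2 = (lin M x).2 + n%:~R by rewrite -hn; ring.
case: M hM {hm hn} => -[a b] [c d]; rewrite /GL2Z /mat_det /lin /= => hM e.
have [e1 [e2 e3]] : p * a + q * c = 0 /\ p * b + q * d = 0 /\ p * m + q * n + r = 0.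
  by apply: ix; rewrite -[RHS]e !intrD !intrM; ring.
(* Cramer's rule, with the determinant as its own inverse. *)
have p0 : p = 0.
  transitivity ((a * d - b * c) * ((p * a + q * c) * d - (p * b + q * d) * c)).
    by rewrite -[LHS]mul1r -hM; ring.
  by rewrite e1 e2; ring.
have q0 : q = 0.
  transitivity ((a * d - b * c) * ((p * b + q * d) * a - (p * a + q * c) * b)).
    by rewrite -[LHS]mul1r -hM; ring.
  by rewrite e1 e2; ring.
by move: e3; rewrite p0 q0 !mul0r !add0r.
Qed.

(** A conjugacy gives [M] and its inverse gives [N] with [N M x] congruent to [x]; independence
    forces [N M = 1], so [M] has determinant 1 or -1. Conversely [lin M] is itself a conjugacy. *)
Lemma Erel_act x y : Erel x y <-> Xmin x /\ exists2 M, GL2Z M & y = act M x.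
Proof.
split=> [[Xx [Xy xy]]|[Xx [M hM ->]]].
  split=> //; have [x1 [x2 ix]] := Xx; have [y1 [y2 iy]] := Xy.
  have [M hM] := top_conj_lin x1 x2 xy.
  have [N hN] := top_conj_lin y1 y2 (top_conj_rot_sym xy).
  exists M; last exact: act_unique.
  have e : mat_mul N M = mat1.
    apply: (rat_indep_lin_inj ix); rewrite lin1 lin_mul.
    apply: tequiv_trans (tequiv_sym hN); exact/lin_tequiv/tequiv_sym.
  have := mat_detM N M; rewrite e /mat1 {1}/mat_det /= => h.
  rewrite /GL2Z /=; have : mat_det N * mat_det M = 1 by rewrite -h.
  move: (mat_det N) (mat_det M) => u v uv.
  have : (`|v| %| 1)%N by rewrite -(absz1) -uv abszM dvdn_mull.
  by rewrite dvdn1 => /eqP v1; have [->|->] : v = 1 \/ v = -1 by lia.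
split=> //; split; first exact: Xmin_act.
exists (lin M); split; first exact: lin_homeo.
move=> p; apply: (@tequiv_trans _ (rot (lin M x) (lin M p))).
  rewrite (_ : rot (lin M x) _ = lin M (rot x p)); first exact: tequiv_refl.
  by rewrite /rot /lin /=; congr (_, _); ring.
have /tequivP[h1 h2] := tequiv_sym (act_tequiv M x).
by apply/tequivP; split; apply: int_diffD => //; exact: int_diff_refl.
Qed.

Lemma Erel_refl x : Xmin x -> Erel x x.
Proof.
move=> Xx; apply/Erel_act; split=> //; exists mat1 => //.
have [x1 [x2 _]] := Xx; apply: act_unique => //; rewrite lin1; exact: tequiv_refl.
Qed.

Lemma Erel_sym x y : Erel x y -> Erel y x.
Proof. by move=> [? [? ?]]; split=> //; split=> //; exact: top_conj_rot_sym. Qed.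

Lemma Erel_trans x y z : Erel x y -> Erel y z -> Erel x z.
Proof.
move=> /Erel_act[Xx [M hM ->]] [_ [Xz]] yz.
have /Erel_act[Xy [N hN ->]] : Erel (act M x) z.
  by split; [exact: Xmin_act|].
apply/Erel_act; split=> //; exists (mat_mul N M).
  by rewrite /GL2Z /= mat_detM mulrACA hM hN.
apply: act_unique; [exact: frac_itv|exact: frac_itv|].
apply: tequiv_trans (act_tequiv _ _) _; rewrite lin_mul.
exact/lin_tequiv/act_tequiv.
Qed.

End conjugacy.

(** * Measurability *)

Section measurability.
Local Notation R := RR.

Lemma measurable_act M : measurable_fun setT (act M).
Proof.
have mlin (a b : int) : measurable_fun setT
    (fun p : R * R => frac (a%:~R * p.1 + b%:~R * p.2)).
  apply: measurableT_comp; first exact: measurable_frac.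
  by apply: measurable_funD; apply: measurable_funM.
by apply: measurable_fun_pair; exact: mlin.
Qed.

Definition line (u : int * int * int) : set (R * R) :=
  [set z | u.1.1%:~R * z.1 + u.1.2%:~R * z.2 + u.2%:~R = 0].

Lemma measurable_line u : measurable (line u).
Proof.
rewrite /line -[X in measurable X]setTI.
rewrite (_ : [set _ | _] = (fun z : R * R =>
  u.1.1%:~R * z.1 + u.1.2%:~R * z.2 + u.2%:~R) @^-1` [set 0]) //.
suff: measurable_fun setT (fun z : R * R =>
  u.1.1%:~R * z.1 + u.1.2%:~R * z.2 + u.2%:~R) by exact.
by do 2! apply: measurable_funD => //; apply: measurable_funM.
Qed.

(** The condition on [u.1] makes every member of this countable union a genuine line, hence null. *)
Definition resonant : set (R * R) :=
  \bigcup_(u in [set u : int * int * int | u.1 != (0, 0)]) line u.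

Lemma XminE : Xmin = (`[0, 1[%classic `*` `[0, 1[%classic) `\` resonant.
Proof.
apply/seteqP; split=> [z [z1 [z2 iz]]|z [[/= z1 z2] nz]].
  split; first by split; rewrite /= in_itv.
  move=> [[[p q] r] /= pq e]; have [p0 [q0 _]] := iz p q r e.
  by rewrite p0 q0 eqxx in pq.
split; first by move: z1; rewrite /= in_itv.
split; first by move: z2; rewrite /= in_itv.
move=> p q r e; have [pq|pq] := eqVneq (p, q) (0, 0); last first.
  by exfalso; apply: nz; exists (p, q, r).
case: pq e => -> -> /eqP; rewrite !mul0r !add0r intr_eq0 => /eqP ->.
by [].
Qed.

(** Reindexing by natural numbers, as countable unions of measurable or negligible sets require. *)
Lemma resonantE : resonant =
  \bigcup_k (if unpickle k is Some u then
    if u.1 != (0, 0) then line u else set0 else set0).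
Proof.
apply/seteqP; split=> z.
  by move=> [u u0 uz]; exists (pickle u); [exact: I|rewrite pickleK ifT].
move=> [k _]; case: (unpickle k) => // u; case: ifP => // u0 uz.
by exists u.
Qed.

Lemma measurable_resonant : measurable resonant.
Proof.
rewrite resonantE; apply: bigcupT_measurable => k.
case: (unpickle k) => // u; case: ifP => // _; exact: measurable_line.
Qed.

Lemma measurable_Xmin : measurable Xmin.
Proof.
rewrite XminE; apply: measurableD; last exact: measurable_resonant.
exact: measurableX.
Qed.

Lemma torus_measure_Xmin : torus_measure Xmin = 1%E.
Proof.
have res0 : torus_measure resonant = 0%E.
  apply: measure_negligible; first exact: measurable_resonant.
  rewrite resonantE; apply: negligible_bigcup => k.
  case: (unpickle k) => [u|]; last exact: negligible_set0.
  case: ifP => [u0|_]; last exact: negligible_set0.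
  apply/negligibleP; first exact: measurable_line.
  apply: line_negligible; move: u u0 => -[[p q] r] /=; apply: contra.
  by rewrite !xpair_eqE !intr_eq0.
have box1 : torus_measure (`[0, 1[%classic `*` `[0, 1[%classic : set (R * R)) = 1%E.
  pose B : set R := `[0, 1[%classic.
  transitivity (circle_measure B * circle_measure B)%E; first exact: product_measure1E.
  suff -> : circle_measure B = 1%E by rewrite mule1.
  rewrite /circle_measure (_ : B `&` _ = `[0 : R, 1 : R[%classic); last exact: setIid.
  by rewrite lebesgue_measure_itv /= lte_fin ltr01 sube0.
rewrite XminE measureD /=; [|exact: measurableX|exact: measurable_resonant|].
  rewrite box1 (_ : torus_measure _ = 0%E) ?sube0 //.
  apply/eqP; rewrite eq_le measure_ge0 andbT -res0.
  apply: le_measure; rewrite ?inE //; last exact: measurable_resonant.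
  by apply: measurableI; [exact: measurableX|exact: measurable_resonant].
by rewrite box1 ltry.
Qed.

(* Without this, [measurable_fun Eset] would hold of every function. *)
Lemma measurable_Eset : measurable Eset.
Proof.
(* A countable union of graphs over [Xmin], one for each matrix. *)
have -> : Eset = \bigcup_(M : mat) (if `[< GL2Z M >] then
    (Xmin `*` setT) `&` [set z | z.2 = act M z.1] else set0).
  apply/seteqP; split=> [[x y] /Erel_act [/= Xx [M hM e]]|[x y] [M _]].
    by exists M => //; rewrite asboolT.
  case: asboolP => // hM [[/= Xx _] e]; apply/Erel_act; split=> //.
  by exists M.
apply: countable_bigcupT_measurable; first exact: countableP.
move=> M; case: asboolP => // _; apply: measurableI.
  by apply: measurableX => //; exact: measurable_Xmin.
have meq (f g : (R * R) * (R * R) -> R) : measurable_fun setT f ->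
    measurable_fun setT g -> measurable [set z | f z = g z].
  move=> mf mg; rewrite (_ : [set _ | _] = (fun z => f z == g z) @^-1` [set true]).
    by rewrite -[X in measurable X]setTI; apply: measurable_fun_eqr.
  by apply/seteqP; split=> z /= => [->|/eqP]; rewrite ?eqxx.
have m1 : measurable_fun setT (fun z : (R * R) * (R * R) => act M z.1).
  by apply: measurableT_comp => //; exact: measurable_act.
rewrite (_ : [set _ | _] = [set z | z.2.1 = (act M z.1).1] `&` [set z | z.2.2 = (act M z.1).2]).
  by apply: measurableI; apply: meq; exact: measurableT_comp.
apply/seteqP; split=> [z /= -> //|[z1 [a b]] /= [-> ->]].
by [].
Qed.

Lemma measurable_esum d (T : measurableType d) (I : countType) (D : set T)
    (J : set I) (f : I -> T -> \bar R) :
  (forall i, J i -> measurable_fun D (f i)) ->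
  (forall i x, J i -> D x -> (0 <= f i x)%E) ->
  measurable_fun D (fun x => \esum_(i in J) f i x).
Proof.
move=> mf f0.
pose g k x := if @pickle_inv I k is Some i then if i \in J then f i x else 0%E else 0%E.
have g0 k x : D x -> (0 <= g k x)%E.
  rewrite /g => Dx; case: (@pickle_inv I k) => // i; case: ifPn => // /set_mem Ji.
  exact: f0.
have mg k : measurable_fun D (g k).
  rewrite /g; case: (@pickle_inv I k) => [i|]; last exact: measurable_cst.
  by case: (boolP (i \in J)) => [/set_mem /mf //|_]; exact: measurable_cst.
apply: (eq_measurable_fun (fun x => \sum_(k <oo) g k x)%E); last first.
  by apply: ge0_emeasurable_sum => // k x Dx _; exact: g0.
move=> x /set_mem Dx; rewrite nneseries_esumT; last by move=> k; exact: g0.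
have -> : \esum_(i in J) f i x = \esum_(i in J) g (pickle i) x.
  by apply: eq_esum => i Ji; rewrite /g pickleK_inv mem_set.
rewrite -(esum_image J pickle (g^~ x)); last by move=> i j _ _; exact: (pcan_inj pickleK).
rewrite [RHS]esum_mkcond; apply: eq_esum => k _.
case: ifPn => // /negP nk; rewrite /g; have := @pickle_invK I k.
case: (@pickle_inv I k) => [i|] //= ik; case: ifPn => // /set_mem Ji.
by exfalso; apply/nk/mem_set; exists i.
Qed.

End measurability.

(** * Almost invariant weights *)

(** Since [A] is conull and stable under [h], extending [s] by 0 reduces this to a change of
    variables on the whole space. *)
Lemma integral_measure_preserving d (T : measurableType d) (R : realType)
    (mu : {measure set T -> \bar R}) (h : T -> T) (A : set T) (s : T -> \bar R) :
  measurable_fun setT h -> (forall B, measurable B -> mu (h @^-1` B) = mu B) ->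
  measurable A -> mu (~` A) = 0%E -> (forall x, A x -> A (h x)) ->
  measurable_fun A s -> (forall x, A x -> (0 <= s x)%E) ->
  (\int[mu]_(x in A) s (h x) = \int[mu]_(x in A) s x)%E.
Proof.
move=> mh hmu mA A0 hA ms s0.
pose s' := s \_ A.
have ms' : measurable_fun setT s' by exact/(measurable_restrictT _ mA).
have s'0 x : (0 <= s' x)%E by rewrite /s' patchE; case: ifPn => // /set_mem /s0.
rewrite [RHS]integral_mkcond -/s'.
transitivity (\int[mu]_(x in A) s' (h x))%E.
  apply: eq_integral => x /set_mem Ax; have /mem_set hx := hA _ Ax.
  by rewrite /s' patchE hx.
have -> : (\int[mu]_(x in A) s' (h x) = \int[mu]_x s' (h x))%E.
  rewrite (@ge0_negligible_integral _ _ _ mu setT (~` A)) //.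
  - by rewrite setTD setCK.
  - exact: measurableC.
  - exact: measurableT_comp.
transitivity (\int[pushforward mu h]_x s' x)%E.
  by rewrite (ge0_integral_pushforward mh).
by apply: eq_measure_integral => B mB _; exact: hmu.
Qed.

Section contraction.
Local Notation R := RR.
Variable mu : probability (R * R)%type R.
Variable phi : nat -> (R * R) * (R * R) -> R.
Variable A : set (R * R).
Hypothesis mphi : forall n, measurable_fun Eset (phi n).
Hypothesis phi0 : forall n z, Eset z -> 0 <= phi n z.
Hypothesis phi1 : forall n x, Xmin x ->
  (\esum_(y in [set y | Erel x y]) ((phi n (x, y))%:E) = 1)%E.
Hypothesis mA : measurable A.
Hypothesis AX : A `<=` Xmin.
Hypothesis A_inv : forall x y, Erel x y -> (A x <-> A y).
Hypothesis muA : mu A = 1%E.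
Hypothesis phi_cvg : forall x x', A x -> A x' -> Erel x x' ->
  (fun n => \esum_(y in [set y | Erel x y])
     ((`|phi n (x, y) - phi n (x', y)|)%:E)) @ \oo --> 0%E.

Lemma Erel_class x y : Erel x y -> [set z | Erel y z] = [set z | Erel x z].
Proof.
move=> xy; apply/seteqP; split=> z /=; first exact: Erel_trans.
exact/Erel_trans/Erel_sym.
Qed.

Lemma class_image x : Xmin x -> [set y | Erel x y] = act^~ x @` GL2Z.
Proof.
move=> Xx; apply/seteqP; split=> [y /Erel_act[_ [M hM ->]]|y [M hM <-]].
  by exists M.
by apply/Erel_act; split=> //; exists M.
Qed.

(** [M] is determined by [act M x], so the sum over a class that varies with [x] becomes a sum over
    a fixed set of matrices. *)
Lemma esum_class x (J : set mat) (S : R * R -> Prop) (f : R * R -> \bar R) :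
  Xmin x -> (forall M, GL2Z M -> S (act M x) <-> J M) ->
  \esum_(y in [set y | Erel x y] `&` [set y | S y]) f y =
  \esum_(M in GL2Z `&` J) f (act M x).
Proof.
move=> Xx SJ; rewrite -(esum_image _ (act^~ x) f); last first.
  by move=> M N _ _; exact: act_inj.
congr esum; rewrite class_image //; apply/seteqP; split.
  by move=> y [[M hM <-]] /= /(SJ _ hM) JM; exists M.
by move=> y [M [hM JM] <-]; split; [exists M|exact/(SJ _ hM)].
Qed.

Lemma measurable_phi_act n M h : GL2Z M -> measurable_fun setT h ->
  (forall x, Xmin x -> Erel x (h x)) ->
  measurable_fun A (fun x => phi n (h x, act M x)).
Proof.
move=> hM mh xh.
apply: (@measurable_comp _ _ _ _ _ _ Eset (phi n) A (fun x => (h x, act M x))) => //.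
- exact: measurable_Eset.
- move=> _ [x Ax <-]; rewrite /Eset /=.
  apply: Erel_trans (Erel_sym (xh _ (AX Ax))) _.
  by apply/Erel_act; split; [exact: AX|exists M].
- apply: measurable_funTS; apply: measurable_fun_pair => //.
  exact: measurable_act.
Qed.

Definition weight (S : R * R -> R * R -> Prop) n x : \bar R :=
  \esum_(y in [set y | Erel x y] `&` [set y | S x y]) (phi n (x, y))%:E.

(** The l^1 distance between the distributions of [x] and [h x] on their common class, when these
    points are equivalent. *)
Definition defect (h : R * R -> R * R) n x : \bar R :=
  \esum_(y in [set y | Erel x y]) (`|phi n (x, y) - phi n (h x, y)|)%:E.

Lemma weight_ge0 S n x : (0 <= weight S n x)%E.
Proof. by apply: esum_ge0 => y [xy _]; rewrite lee_fin phi0. Qed.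

Lemma defect_ge0 h n x : (0 <= defect h n x)%E.
Proof. by apply: esum_ge0 => y xy; rewrite lee_fin. Qed.

(** By hypothesis membership in the sector depends on the matrix alone, so the weight is a countable
    sum with index set independent of [x]. *)
Lemma measurable_weight S (J : set mat) n :
  (forall x M, Xmin x -> GL2Z M -> S x (act M x) <-> J M) ->
  measurable_fun A (weight S n).
Proof.
move=> SJ.
apply: (eq_measurable_fun (fun x => \esum_(M in GL2Z `&` J) (phi n (x, act M x))%:E)).
  move=> x /set_mem /AX Xx; rewrite /weight.
  by rewrite (@esum_class x J (S x) (fun y => (phi n (x, y))%:E)) // => M; exact: SJ.
apply: measurable_esum => [M [hM _]|M x [hM _] /AX Xx].
  apply/measurable_EFinP; apply: (@measurable_phi_act n M id) => // x Xx.
  exact: Erel_refl.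
rewrite lee_fin phi0 // /Eset /=; apply/Erel_act; split=> //.
by exists M.
Qed.

Lemma measurable_defect h n : measurable_fun setT h ->
  (forall x, Xmin x -> Erel x (h x)) -> measurable_fun A (defect h n).
Proof.
move=> mh xh.
apply: (eq_measurable_fun
    (fun x => \esum_(M in GL2Z `&` setT) (`|phi n (x, act M x) - phi n (h x, act M x)|)%:E)).
  move=> x /set_mem /AX Xx; rewrite /defect.
  rewrite -(@esum_class x setT (fun=> True) (fun y => (`|phi n (x, y) - phi n (h x, y)|)%:E)) //.
  by congr esum; rewrite (_ : [set y | True] = setT) ?setIT.
apply: measurable_esum => [M [hM _]|M x _ _]; last by rewrite lee_fin.
apply/measurable_EFinP; apply: measurableT_comp => //.
apply: measurable_funB; last exact: measurable_phi_act.
apply: (@measurable_phi_act n M id) => // x Xx.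
exact: Erel_refl.
Qed.

Lemma defect_le2 h n x : Xmin x -> Erel x (h x) -> (defect h n x <= 2%:E)%E.
Proof.
move=> Xx xh; have Xhx : Xmin (h x) by case: xh => _ [].
have -> : 2%:E = (1 + 1 : \bar R)%E by rewrite -EFinD.
rewrite -{1}(phi1 n Xx) -(phi1 n Xhx) (Erel_class xh) -esumD; last 2 first.
- by move=> y xy; rewrite lee_fin phi0.
- by move=> y xy; rewrite lee_fin phi0 // /Eset /=; exact: Erel_trans (Erel_sym xh) xy.
apply: le_esum => y xy; rewrite -EFinD lee_fin.
apply: le_trans (ler_normB _ _) _; rewrite !ger0_norm ?phi0 //.
exact: Erel_trans (Erel_sym xh) xy.
Qed.

(** Dominated convergence: the defects tend to 0 on [A] and, as distances between distributions of
    mass 1, are at most 2. *)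
Lemma integral_defect_cvg h : measurable_fun setT h ->
  (forall x, Xmin x -> Erel x (h x)) ->
  (\int[mu]_(x in A) defect h n x)%E @[n --> \oo] --> 0%E.
Proof.
move=> mh xh.
have cvg0 : {ae mu, forall x, A x -> defect h n x @[n --> \oo] --> cst 0%E x}.
  apply/aeW => x Ax; apply: phi_cvg => //; last exact/xh/AX.
  by apply/(A_inv (xh _ (AX Ax))).
have int2 : mu.-integrable A (cst 2%:E).
  exact: finite_measure_integrable_cst.
have bnd : {ae mu, forall x n, A x -> (`|defect h n x| <= cst 2%:E x)%E}.
  apply/aeW => x n Ax; rewrite gee0_abs ?defect_ge0 //.
  by apply: defect_le2; [exact: AX|exact/xh/AX].
have [_ _] := dominated_convergence mA (fun n => measurable_defect n mh xh)
  (@measurable_cst _ _ _ _ A 0%E) cvg0 int2 bnd.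
by rewrite integral0.
Qed.

(** The three sectors are disjoint within one class. Replacing the distributions of [h1 x] and
    [h2 x] by that of [x] costs at most the defects, and the latter has total mass 1. *)
Lemma weight_le3 S h1 h2 n x : Xmin x -> Erel x (h1 x) -> Erel x (h2 x) ->
  (forall y, Erel x y -> S x y -> S (h1 x) y -> False) ->
  (forall y, Erel x y -> S x y -> S (h2 x) y -> False) ->
  (forall y, Erel x y -> S (h1 x) y -> S (h2 x) y -> False) ->
  (weight S n x + weight S n (h1 x) + weight S n (h2 x) <=
   1 + (defect h1 n x + defect h2 n x))%E.
Proof.
move=> Xx xh1 xh2 d01 d02 d12.
have mkcond (P : set (R * R)) (f : R * R -> \bar R) :
    \esum_(y in [set y | Erel x y] `&` P) f y =
    \esum_(y in [set y | Erel x y]) (if y \in P then f y else 0%E).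
  exact: esum_mkcondr.
rewrite /weight (Erel_class xh1) (Erel_class xh2) 3!mkcond.
have p1 y : Erel x y -> 0 <= phi n (h1 x, y).
  by move=> xy; apply: phi0; exact: Erel_trans (Erel_sym xh1) xy.
have p2 y : Erel x y -> 0 <= phi n (h2 x, y).
  by move=> xy; apply: phi0; exact: Erel_trans (Erel_sym xh2) xy.
have p0 y : Erel x y -> 0 <= phi n (x, y) by move=> xy; exact: phi0.
rewrite -(phi1 n Xx) /defect -!esumD; try
  by move=> y xy; rewrite ?adde_ge0 //; try (case: ifP => // _); rewrite lee_fin ?p0 ?p1 ?p2.
apply: le_esum => y xy; have := p0 y xy; have := p1 y xy; have := p2 y xy.
rewrite -!EFinD.
(* At each [y] at most one of the three terms survives, and it exceeds [phi n (x, y)] by at most one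
   of the two differences. *)
have le_norm (u v : R) : v <= u + `|u - v|.
  by rewrite -lerBlDl; apply: le_trans (ler_norm _) _; rewrite distrC.
have n1 := le_norm (phi n (x, y)) (phi n (h1 x, y)).
have n2 := le_norm (phi n (x, y)) (phi n (h2 x, y)).
have a1 := normr_ge0 (phi n (x, y) - phi n (h1 x, y)).
have a2 := normr_ge0 (phi n (x, y) - phi n (h2 x, y)).
case: ifPn => [/set_mem s0|_]; case: ifPn => [/set_mem s1|_];
  case: ifPn => [/set_mem s2|_] q2 q1 q0; rewrite -?EFinD ?add0e ?adde0 ?lee_fin;
  solve [by case: (d01 y xy)|by case: (d02 y xy)|by case: (d12 y xy)|lra].
Qed.

(** Integrating the previous bound: since [h1] and [h2] preserve [mu], the three weights have the
    same integral. *)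
Lemma integral_weight_le S (J : set mat) h1 h2 n :
  (forall x M, Xmin x -> GL2Z M -> S x (act M x) <-> J M) ->
  measurable_fun setT h1 -> measurable_fun setT h2 ->
  (forall B, measurable B -> mu (h1 @^-1` B) = mu B) ->
  (forall B, measurable B -> mu (h2 @^-1` B) = mu B) ->
  (forall x, Xmin x -> Erel x (h1 x)) -> (forall x, Xmin x -> Erel x (h2 x)) ->
  (forall x y, Erel x y -> S x y -> S (h1 x) y -> False) ->
  (forall x y, Erel x y -> S x y -> S (h2 x) y -> False) ->
  (forall x y, Erel x y -> S (h1 x) y -> S (h2 x) y -> False) ->
  (\int[mu]_(x in A) weight S n x + \int[mu]_(x in A) weight S n x +
     \int[mu]_(x in A) weight S n x <= 1 + (\int[mu]_(x in A) defect h1 n x +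
     \int[mu]_(x in A) defect h2 n x))%E.
Proof.
move=> SJ mh1 mh2 ph1 ph2 xh1 xh2 d01 d02 d12.
have muAC : mu (~` A) = 0%E by rewrite probability_setC // muA subee.
have mw : measurable_fun A (weight S n) by exact: measurable_weight SJ.
have inv h : measurable_fun setT h -> (forall B, measurable B -> mu (h @^-1` B) = mu B) ->
    (forall x, Xmin x -> Erel x (h x)) ->
    measurable_fun A (fun x => weight S n (h x)) /\
    (\int[mu]_(x in A) weight S n (h x) = \int[mu]_(x in A) weight S n x)%E.
  move=> mh ph xh; have hA x : A x -> A (h x).
    by move=> Ax; apply/(A_inv (xh _ (AX Ax))).
  split; last by apply: integral_measure_preserving => // x _; exact: weight_ge0.
  apply: (@measurable_comp _ _ _ _ _ _ A (weight S n) A h) => //.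
    by move=> _ [x Ax <-]; exact: hA.
  exact: measurable_funTS.
have [m1 e1] := inv _ mh1 ph1 xh1; have [m2 e2] := inv _ mh2 ph2 xh2.
have md1 : measurable_fun A (defect h1 n) by exact: measurable_defect.
have md2 : measurable_fun A (defect h2 n) by exact: measurable_defect.
have w0 x : (0 <= weight S n x)%E := weight_ge0 S n x.
have D10 x : (0 <= defect h1 n x)%E := defect_ge0 h1 n x.
have D20 x : (0 <= defect h2 n x)%E := defect_ge0 h2 n x.
have mw12 : measurable_fun A (fun x => weight S n x + weight S n (h1 x))%E.
  exact: emeasurable_funD.
have mD : measurable_fun A (fun x => defect h1 n x + defect h2 n x)%E.
  exact: emeasurable_funD.
have -> : (\int[mu]_(x in A) weight S n x + \int[mu]_(x in A) weight S n x +
     \int[mu]_(x in A) weight S n x = \int[mu]_(x in A)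
       (weight S n x + weight S n (h1 x) + weight S n (h2 x)))%E.
  rewrite ge0_integralD //; last by move=> x _; exact: adde_ge0.
  by rewrite ge0_integralD // e1 e2.
have -> : (1 + (\int[mu]_(x in A) defect h1 n x + \int[mu]_(x in A) defect h2 n x) =
    \int[mu]_(x in A) (1 + (defect h1 n x + defect h2 n x)))%E.
  rewrite ge0_integralD //; last by move=> x _; exact: adde_ge0.
  rewrite ge0_integralD // (_ : \int[mu]_(x in A) 1 = 1)%E //.
  by transitivity (1 * mu A)%E; [exact: integral_cst|rewrite muA mule1].
apply: ge0_le_integral => //.
- by move=> x _; rewrite !adde_ge0.
- exact: emeasurable_funD.
- exact: emeasurable_funD.
- move=> x Ax; have Xx := AX Ax.
  by apply: weight_le3; [|exact: xh1|exact: xh2|move=> y; exact: d01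
    |move=> y; exact: d02|move=> y; exact: d12].
Qed.


(** Every point of the class lies in at least one of the sectors, so the two weights add up to at
    least the total mass. *)
Lemma integral_weight_cover S1 S2 (J1 J2 : set mat) n :
  (forall x M, Xmin x -> GL2Z M -> S1 x (act M x) <-> J1 M) ->
  (forall x M, Xmin x -> GL2Z M -> S2 x (act M x) <-> J2 M) ->
  J1 `|` J2 = setT ->
  (1 <= \int[mu]_(x in A) weight S1 n x + \int[mu]_(x in A) weight S2 n x)%E.
Proof.
move=> SJ1 SJ2 J12.
have m1 : measurable_fun A (weight S1 n) := measurable_weight n SJ1.
have m2 : measurable_fun A (weight S2 n) := measurable_weight n SJ2.
have w1 x : (0 <= weight S1 n x)%E := weight_ge0 S1 n x.
have w2 x : (0 <= weight S2 n x)%E := weight_ge0 S2 n x.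
rewrite -ge0_integralD //.
have <- : (\int[mu]_(x in A) 1 = 1)%E.
  by transitivity (1 * mu A)%E; [exact: integral_cst|rewrite muA mule1].
apply: ge0_le_integral => //; first exact: emeasurable_funD.
move=> x /AX Xx; rewrite -{1}(phi1 n Xx).
have mkcond (P : set (R * R)) (f : R * R -> \bar R) :
    \esum_(y in [set y | Erel x y] `&` P) f y =
    \esum_(y in [set y | Erel x y]) (if y \in P then f y else 0%E).
  exact: esum_mkcondr.
have p0 y : Erel x y -> (0 <= (phi n (x, y))%:E)%E.
  by move=> xy; rewrite lee_fin; exact: phi0.
rewrite /weight 2!mkcond -esumD; last 2 first.
- by move=> y xy; case: ifP => // _; exact: p0.
- by move=> y xy; case: ifP => // _; exact: p0.
apply: le_esum => y /[dup] xy /Erel_act[_ [M hM yM]].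
have := p0 y xy; case: ifPn => [_|s1]; case: ifPn => [_|s2] h; rewrite ?add0e ?adde0 //.
  by rewrite leeDl.
exfalso; have : (J1 `|` J2) M by rewrite J12.
move=> [/(SJ1 _ _ Xx hM)|/(SJ2 _ _ Xx hM)]; rewrite -yM => h'.
- by move/negP: s1; apply; exact/mem_set.
- by move/negP: s2; apply; exact/mem_set.
Qed.

End contraction.

(** * Sectors of first rows and their images under shears *)

Section sectors.
Local Notation R := RR.

(* [(a, b)] is the first row of the matrix taking [x] to [y]. *)
Definition sector1 (x y : R * R) : Prop := exists a b k : int,
  y.1 = a%:~R * x.1 + b%:~R * x.2 + k%:~R /\ `|b| <= `|a|.
Definition sector2 (x y : R * R) : Prop := exists a b k : int,
  y.1 = a%:~R * x.1 + b%:~R * x.2 + k%:~R /\ `|a| <= `|b|.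
Definition flat : set mat := [set M | `|M.1.2| <= `|M.1.1|].
Definition steep : set mat := [set M | `|M.1.1| <= `|M.1.2|].

Lemma rat_indep_inj (x : R * R) (a b k a' b' k' : int) : rat_indep x ->
  a%:~R * x.1 + b%:~R * x.2 + k%:~R = a'%:~R * x.1 + b'%:~R * x.2 + k'%:~R ->
  a = a' /\ b = b'.
Proof.
move=> ix e; have [|e1 [e2 _]] := ix (a - a') (b - b') (k - k').
  by rewrite !intrB; lra.
by move/eqP: e1; move/eqP: e2; rewrite !subr_eq0 => /eqP-> /eqP->.
Qed.

Lemma act1_lin M (x : R * R) :
  (act M x).1 = M.1.1%:~R * x.1 + M.1.2%:~R * x.2 + (- Num.floor (lin M x).1)%:~R.
Proof. by rewrite /act /frac /lin /= intrN. Qed.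

(** By independence the coefficients in [sector1] can only be the first row of [M]. *)
Lemma sector1_act x M : Xmin x -> sector1 x (act M x) <-> flat M.
Proof.
move=> [_ [_ ix]]; split=> [[a [b [k []]]]|h].
  by rewrite act1_lin => /(rat_indep_inj ix)[<- <-].
by exists M.1.1, M.1.2, (- Num.floor (lin M x).1); rewrite act1_lin.
Qed.

Lemma sector2_act x M : Xmin x -> sector2 x (act M x) <-> steep M.
Proof.
move=> [_ [_ ix]]; split=> [[a [b [k []]]]|h].
  by rewrite act1_lin => /(rat_indep_inj ix)[<- <-].
by exists M.1.1, M.1.2, (- Num.floor (lin M x).1); rewrite act1_lin.
Qed.

Lemma shear1_Erel k x : Xmin x -> Erel x (shear1 k x).
Proof.
move=> Xx; have [x1 [x2 ix]] := Xx; apply/Erel_act; split=> //.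
exists ((1, k), (0, 1)); first by rewrite /GL2Z /mat_det /=; ring.
apply: act_unique => //; first exact: frac_itv.
exists (- Num.floor (x.1 + k%:~R * x.2)), 0.
by rewrite /shear1 /lin /frac /= intrN; split; ring.
Qed.

Lemma shear2_Erel k x : Xmin x -> Erel x (shear2 k x).
Proof.
move=> Xx; have [x1 [x2 ix]] := Xx; apply/Erel_act; split=> //.
exists ((1, 0), (k, 1)); first by rewrite /GL2Z /mat_det /=; ring.
apply: act_unique => //; first exact: frac_itv.
exists 0, (- Num.floor (x.2 + k%:~R * x.1)).
by rewrite /shear2 /lin /frac /= intrN; split; ring.
Qed.

(* The sectors [`|b + k * a| <= `|a|], for [k] in [3Z], meet only at the origin. *)
Lemma sector1_shear1 k l x y : Erel x y -> 3 <= `|k - l| ->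
  sector1 (shear1 k x) y -> sector1 (shear1 l x) y -> False.
Proof.
move=> [[_ [_ ix]] [[_ [_ iy]] _]] kl [a [b [m [e h]]]] [a' [b' [m' [e' h']]]].
have E (c d r s : int) : y.1 = c%:~R * (shear1 s x).1 + d%:~R * (shear1 s x).2 + r%:~R ->
    y.1 = c%:~R * x.1 + (d + s * c)%:~R * x.2 +
      (r - c * Num.floor (x.1 + s%:~R * x.2))%:~R.
  by rewrite /shear1 /frac /= intrD intrB !intrM => ->; ring.
have e1 := E _ _ _ _ e; have e2 := E _ _ _ _ e'.
have [aa bb] := rat_indep_inj ix (etrans (esym e1) e2).
(* Here [a = a'] and [b' - b = (k - l) * a]; the left side is at most [2 * |a|] in absolute value,
   the right side at least [3 * |a|]. *)
have [a0|a0] := eqVneq a 0; last by nia.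
have b0 : b = 0 by move: h; rewrite a0; lia.
(* With a zero row [y.1] would be an integer. *)
have [] := iy 1 0 (- m); last by [].
by rewrite e a0 b0 intrN; ring.
Qed.

(** The same argument with the columns exchanged: the shear now fixes [b] and adds multiples of [b]
    to [a]. *)
Lemma sector2_shear2 k l x y : Erel x y -> 3 <= `|k - l| ->
  sector2 (shear2 k x) y -> sector2 (shear2 l x) y -> False.
Proof.
move=> [[_ [_ ix]] [[_ [_ iy]] _]] kl [a [b [m [e h]]]] [a' [b' [m' [e' h']]]].
have E (c d r s : int) : y.1 = c%:~R * (shear2 s x).1 + d%:~R * (shear2 s x).2 + r%:~R ->
    y.1 = (c + s * d)%:~R * x.1 + d%:~R * x.2 +
      (r - d * Num.floor (x.2 + s%:~R * x.1))%:~R.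
  by rewrite /shear2 /frac /= intrD intrB !intrM => ->; ring.
have e1 := E _ _ _ _ e; have e2 := E _ _ _ _ e'.
have [aa bb] := rat_indep_inj ix (etrans (esym e1) e2).
have [b0|b0] := eqVneq b 0; last by nia.
have a0 : a = 0 by move: h; rewrite b0; lia.
have [] := iy 1 0 (- m); last by [].
by rewrite e a0 b0 intrN; ring.
Qed.

End sectors.

(** In the finite case [3 <= 3 * (a + b) <= 2 + c + d]. *)
Lemma ereal_thirds (R : realType) (a b c d : \bar R) :
  (0 <= a -> 0 <= b -> 0 <= c -> 0 <= d -> 1 <= a + b ->
   a + a + a <= 1 + c -> b + b + b <= 1 + d -> 1 <= c + d)%E.
Proof.
case: a => [a| |] //; case: b => [b| |] //; case: c => [c| |] //;
  case: d => [d| |] //; rewrite ?addye ?addey // -?EFinD ?lee_fin ?leey ?leye_eq //.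
by lra.
Qed.

Theorem theorem1p2 : ~ amenable_E.
Proof.
move=> amenable; pose mu : probability (RR * RR)%type RR := @torus_measure RR.
have [phi [mphi [phi0 [phi1 [A [mA [AX [A_inv [muA phi_cvg]]]]]]]]] :=
  amenable mu torus_measure_Xmin.
pose def h n := (\int[mu]_(x in A) defect phi h n x)%E.
have def_cvg h : measurable_fun setT h -> (forall x, Xmin x -> Erel x (h x)) ->
    def h n @[n --> \oo] --> 0%E.
  by move=> mh xh; exact: (integral_defect_cvg mu mphi phi0 phi1 mA AX A_inv phi_cvg mh xh).
(* The parameters 0, 3 and 6 are pairwise at least 3 apart, as disjointness of the sheared sectors
   requires. *)
pose e1 n := (def (shear1 3) n + def (shear1 6) n)%E.
pose e2 n := (def (shear2 3) n + def (shear2 6) n)%E.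
have e_cvg : (e1 n + e2 n)%E @[n --> \oo] --> 0%E.
  have add0 (u v : nat -> \bar RR) : u n @[n --> \oo] --> 0%E ->
      v n @[n --> \oo] --> 0%E -> (u n + v n)%E @[n --> \oo] --> 0%E.
    by move=> hu hv; rewrite -[X in _ --> X]adde0; exact: cvgeD.
  by apply: (add0); apply: (add0); apply: def_cvg => [|x]; first [exact: measurable_shear1
    |exact: measurable_shear2|exact: shear1_Erel|exact: shear2_Erel].
(* The unsheared sector is thereby the case [k = 0] of the disjointness lemmas. *)
have sh1 x : Xmin x -> shear1 0 x = x.
  by case: x => x1 x2 [/= h _]; rewrite /shear1 /= mul0r addr0 frac_id.
have sh2 x : Xmin x -> shear2 0 x = x.
  by case: x => x1 x2 [_ [/= h _]]; rewrite /shear2 /= mul0r addr0 frac_id.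
have le1 n : (1 <= e1 n + e2 n)%E.
  have w0 S x : (0 <= weight phi S n x)%E by exact: weight_ge0.
  have d0 h x : (0 <= defect phi h n x)%E by exact: defect_ge0.
  apply: (@ereal_thirds _ (\int[mu]_(x in A) weight phi sector1 n x)%E
    (\int[mu]_(x in A) weight phi sector2 n x)%E).
  - by apply: integral_ge0 => x _.
  - by apply: integral_ge0 => x _.
  - by apply: adde_ge0; apply: integral_ge0 => x _.
  - by apply: adde_ge0; apply: integral_ge0 => x _.
  - apply: (@integral_weight_cover mu phi A mphi phi0 phi1 mA AX muA sector1 sector2 flat steep).
    + by move=> x M Xx _; exact: sector1_act.
    + by move=> x M Xx _; exact: sector2_act.
    + apply/seteqP; split=> // M _; rewrite /setU /flat /steep /=.
      by case: (leP `|M.1.2| `|M.1.1|) => h; [left|right; exact: ltW].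
  - apply: (@integral_weight_le mu phi A mphi phi0 phi1 mA AX A_inv muA sector1 flat).
    + by move=> x M Xx _; exact: sector1_act.
    + exact: measurable_shear1.
    + exact: measurable_shear1.
    + by move=> B; exact: shear1_preserving.
    + by move=> B; exact: shear1_preserving.
    + exact: shear1_Erel.
    + exact: shear1_Erel.
    + by move=> x y xy; rewrite -{1}(sh1 _ xy.1); exact: sector1_shear1.
    + by move=> x y xy; rewrite -{1}(sh1 _ xy.1); exact: sector1_shear1.
    + by move=> x y xy; exact: sector1_shear1.
  - apply: (@integral_weight_le mu phi A mphi phi0 phi1 mA AX A_inv muA sector2 steep).
    + by move=> x M Xx _; exact: sector2_act.
    + exact: measurable_shear2.
    + exact: measurable_shear2.
    + by move=> B; exact: shear2_preserving.
    + by move=> B; exact: shear2_preserving.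
    + exact: shear2_Erel.
    + exact: shear2_Erel.
    + by move=> x y xy; rewrite -{1}(sh2 _ xy.1); exact: sector2_shear2.
    + by move=> x y xy; rewrite -{1}(sh2 _ xy.1); exact: sector2_shear2.
    + by move=> x y xy; exact: sector2_shear2.
have : (1%:E <= 0 :> \bar RR)%E by apply: cvge_ge e_cvg; exact: nearW.
by rewrite lee_fin ler10.
Qed.
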